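(* For $1/2<p<1$ let $$s^*(p)=\frac{1-3p+2\sqrt{p(2p-1)}}{p-1},$$ and let $p^*\approx0.6504$ be the unique solution in $(1/2,1)$ of $\log(4)=\dfrac{1+p}{1+s^*(p)}$. Let $p^*<p<1$, let $M(t)=1-p+pe^t$ be the moment generating function of the $\mathrm{Bernoulli}(p)$ distribution, and let $I(a)=\sup_{t\in\mathbb{R}}\{at-\log M(t)\}$. Then $$\log(4)\,\frac{s}{s+1}<I\left(p+\frac{2\sqrt{p(1-p)}\,\sqrt{s}}{1+s}\right)\qquad\text{for all } s\in(0,1).$$
   Context: $s^*(p)$ is the unique solution $s\in(0,1)$ of $p+\frac{2\sqrt{p(1-p)}\sqrt{s}}{1+s}=1$. The $\mathrm{Bernoulli}(p)$ distribution has mean $m=p$ and standard deviation $\sigma=\sqrt{p(1-p)}$. With $g_{\mathrm{Exp}}(x,y)=m(x+y)+2\sigma\sqrt{xy}$, the argument of $I$ is $g_{\mathrm{Exp}}(1,s)/(1+s)$. The rate function $I$ takes values in $[0,+\infty]$, and the inequality is considered to hold when the right side is $+\infty$. *)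

(* Defs.v *)
From mathcomp Require Import all_boot all_order all_algebra.
From mathcomp Require Import all_classical all_reals all_analysis.

Set Implicit Arguments.
Unset Strict Implicit.
Unset Printing Implicit Defensive.

Import Order.TTheory GRing.Theory Num.Theory.
Import numFieldNormedType.Exports.

Local Open Scope classical_set_scope.
Local Open Scope ring_scope.

Definition s_star (R : realType) (p : R) : R :=
  (1 - 3 * p + 2 * Num.sqrt (p * (2 * p - 1))) / (p - 1).

Definition is_p_star (R : realType) (q : R) : Prop :=
  1 / 2 < q < 1 /\ ln 4 = (1 + q) / (1 + s_star q).

Definition bernoulli_mgf (R : realType) (p t : R) : R := 1 - p + p * expR t.

Lemma mmt_gen_fun_bernoulli (R : realType) (p t : R) (p01 : 0 <= p <= 1) :
  mmt_gen_fun (bernoulli_prob p) (fun b : bool => b%:R) t =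
  (bernoulli_mgf p t)%:E.
Proof.
rewrite /mmt_gen_fun unlock integral_bernoulli_prob//=.
by rewrite mul1r mul0r expR0 mule1 -EFinM -EFinD /bernoulli_mgf addrC.
Qed.

Definition rate_function (R : realType) (M : R -> R) (a : R) : \bar R :=
  ereal_sup [set (a * t - ln (M t))%:E | t in [set: R]].

(* Main.v *)
Require Import Defs.
From mathcomp Require Import all_boot all_order all_algebra.
From mathcomp Require Import all_classical all_reals all_analysis.
From mathcomp Require Import ring lra.

Import Order.TTheory GRing.Theory Num.Theory.
Import numFieldNormedType.Exports.

Local Open Scope classical_set_scope.
Local Open Scope ring_scope.

(** The heart of the matter is Hoeffding's one-sided variance bound: for
    [p >= 1/2] and [t >= 0],
      [ln M(t) <= p t + p (1 - p) t^2 / 2],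
    which by duality, at [t = (a - p) / (p (1 - p))], gives
      [I(a) >= (a - p)^2 / (2 p (1 - p))]  for [a >= p].
    At the argument [a] of the theorem, [(a - p)^2] is exactly
    [4 p (1 - p) s / (1 + s)^2], so with [u = 1 / (1 + s)] the bound reads
    [I(a) >= 2 u (s u)] and the claim [ln 4 * (s u) < I(a)] follows from
    [ln 4 < 2 u].

    If [a > 1] then [I(a) = +oo].  Otherwise [a <= 1] says
    [4 u (1 - u) <= (1 - p) / p], that is [(2 u - 1)^2 >= 2 - 1/p], hence
    [2 u >= 1 + sqrt (2 - 1/p)] (as [u > 1/2]).  On the other hand
      [(1 + p) / (1 + s_star p) = (1 + p) (1 + sqrt (2 - 1/p)) / 2]
    (lemma [s_star_threshold]) is increasing in [p], equals [ln 4] at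
    [p_star], and is less than [1 + sqrt (2 - 1/p)] because [p < 1]; so
    [ln 4 < 2 u] for [p > p_star].

    Existence and location of [p_star] come from the intermediate value
    theorem between [0.65035] and [0.65045].  As [p_star = 0.650359...] lies
    very close to the left end, [ln 4] must be known from below to within
    about [2 * 10^-5]; the estimate is read off the series of
    [ln ((1 + x) / (1 - x))] at [x = 1/3]. *)

(** * The quadratic bound on the Bernoulli cumulant function *)

Lemma ge0_derive_le_endpoints {R : realType} (f df : R -> R) (b : R) :
  0 <= b -> (forall x, 0 <= x <= b -> is_derive x 1 f (df x)) ->
  (forall x, 0 <= x <= b -> 0 <= df x) -> f 0 <= f b.
Proof.
move=> b0 dfx df0.
have cf : {within `[0, b], continuous f}.
  apply: derivable_within_continuous => x; rewrite in_itv/= => /dfx h.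
  exact: ex_derive.
have dfo x : x \in `]0, b[ -> is_derive x 1 f (df x).
  by rewrite in_itv/= => /andP[? ?]; apply: dfx; rewrite !ltW.
have [c] := MVT_segment b0 dfo cf.
rewrite in_itv/= => cb e; rewrite -subr_ge0 e mulr_ge0 ?df0//; lra.
Qed.

(** This is [(2 - t) exp t <= 2 + t], the sign condition met when
    differentiating the cumulant bound below, in its extreme case [p = 1/2].
    The derivative is nonnegative because [exp (- t) >= 1 - t]. *)
Lemma expR_pade_ge0 {R : realType} (t : R) : 0 <= t ->
  0 <= 1 + t / 2 + t * expR t / 2 - expR t.
Proof.
move=> t0.
pose f (x : R) := 1 + x / 2 + x * expR x / 2 - expR x.
have f0 : f 0 = 0 by rewrite /f expR0; field.
rewrite -[leRHS]/(f t) -f0.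
apply: (@ge0_derive_le_endpoints _ f
  (fun x => (1 - (1 - x) * expR x) / 2) t t0) => x /andP[x0 _].
  rewrite /f; apply: is_derive_eq.
  by rewrite /= /GRing.scale/=; field.
rewrite divr_ge0// subr_ge0.
have := expR_ge1Dx (- x); rewrite expRN => h.
by rewrite -ler_pdivlMr ?expR_gt0// mul1r.
Qed.

(** Both sides vanish at [0].  Up to a positive factor [p (1 - p) / M], the
    difference of their derivatives is
    [1 + (1 - p) t + p t exp t - exp t], which is affine in [p] with slope
    [t (exp t - 1) >= 0]; so it is enough to know its sign at [p = 1/2]. *)
Lemma ln_bernoulli_mgf_le {R : realType} (p t : R) : 1 / 2 <= p < 1 -> 0 <= t ->
  ln (bernoulli_mgf p t) <= p * t + p * (1 - p) * t ^+ 2 / 2.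
Proof.
move=> /andP[p1 p2] t0; rewrite -subr_ge0.
pose M (x : R) := 1 - p + p * expR x.
have Mgt0 x : 0 < M x by rewrite /M; have := expR_gt0 x; nra.
pose f (x : R) := p * x + p * (1 - p) * x ^+ 2 / 2 - ln (M x).
have f0 : f 0 = 0 by rewrite /f /M expR0 mulr1 subrK ln1; ring.
rewrite -[leRHS]/(f t) -f0.
apply: (@ge0_derive_le_endpoints _ f
  (fun x => p + p * (1 - p) * x - p * expR x / M x) t t0) => x /andP[x0 _].
  have dM : is_derive x 1 M (p * expR x).
    apply: is_derive_eq; rewrite /= /GRing.scale/=; ring.
  have dl : is_derive x 1 (fun y => ln (M y)) ((M x)^-1 * (p * expR x)).
    exact: (@is_derive1_comp _ (@ln R) M x _ _ (is_derive1_ln (Mgt0 x)) dM).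
  rewrite /f; apply: is_derive_eq.
  by rewrite /= /GRing.scale/=; field; rewrite gt_eqF.
rewrite subr_ge0 ler_pdivrMr//.
have h := expR_pade_ge0 x x0.
have e1 : 1 <= expR x by rewrite (le_trans _ (expR_ge1Dx x))//; lra.
have : 0 <= p * (1 - p) * (1 + (1 - p) * x + p * x * expR x - expR x).
  apply: mulr_ge0; first by nra.
  have : 0 <= (p - 1/2) * (x * (expR x - 1)) by rewrite !mulr_ge0; lra.
  lra.
rewrite /M; lra.
Qed.

(** * Lower bounds on the rate function *)

Lemma rate_function_ge {R : realType} (M : R -> R) (a t : R) :
  ((a * t - ln (M t))%:E <= rate_function M a)%E.
Proof. by apply: ereal_sup_ubound; exists t. Qed.

Lemma rate_function_bernoulli_ge {R : realType} (p a : R) :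
  1 / 2 <= p < 1 -> p <= a ->
  (((a - p) ^+ 2 / (2 * (p * (1 - p))))%:E
     <= rate_function (bernoulli_mgf p) a)%E.
Proof.
move=> p12 pa; have /andP[p1 p2] := p12.
set v := p * (1 - p); have v0 : 0 < v by rewrite /v; nra.
apply: le_trans (rate_function_ge _ _ ((a - p) / v)).
have t0 : 0 <= (a - p) / v by rewrite divr_ge0 ?subr_ge0// ltW.
rewrite lee_fin; have := ln_bernoulli_mgf_le _ _ p12 t0; rewrite -/v.
suff -> : (a - p) ^+ 2 / (2 * v) =
  a * ((a - p) / v) - (p * ((a - p) / v) + v * ((a - p) / v) ^+ 2 / 2) by lra.
by field; rewrite gt_eqF.
Qed.

(** [M(t) <= exp t] for [t >= 0], so the function [a t - ln M(t)] grows at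
    least like [(a - 1) t]. *)
Lemma rate_function_bernoulli_eqy {R : realType} (p a : R) :
  0 <= p <= 1 -> 1 < a -> rate_function (bernoulli_mgf p) a = +oo%E.
Proof.
move=> /andP[p0 p1] a1; apply/eqyP => A A0.
have a1' : 0 < a - 1 by rewrite subr_gt0.
apply: le_trans (rate_function_ge _ _ (A / (a - 1))); rewrite lee_fin.
set t := A / (a - 1); have t0 : 0 < t by rewrite divr_gt0.
have -> : A = (a - 1) * t by rewrite /t mulrC divfK// gt_eqF.
suff : ln (bernoulli_mgf p t) <= t by lra.
have e1 : 1 < expR t by rewrite expR_gt1.
rewrite -ler_expR lnK ?posrE /bernoulli_mgf; nra.
Qed.

(** * Numerical bounds for ln 4 *)

(** The logarithm is [2 artanh x], compared with its Taylor polynomial of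
    degree 9 whose last term has weight [c].  The weight serves to get lower and
    upper bounds from one formula: [c = 1] truncates the series, and a suitable
    [c > 1] absorbs its tail. *)
Definition artanh_gap {R : realType} (c x : R) : R :=
  ln (1 + x) - ln (1 - x) -
  2 * (x + x ^+ 3 / 3 + x ^+ 5 / 5 + x ^+ 7 / 7 + c * (x ^+ 9 / 9)).

(** The derivative of the logarithms is the sum [2 / (1 - x^2)] of a geometric
    series, so that only the top-degree terms survive.  The sign of the result
    is that of [1 - c + c x^2]. *)
Lemma is_derive_artanh_gap {R : realType} (c x : R) : -1 < x < 1 ->
  is_derive x 1 (artanh_gap c)
    (2 * x ^+ 8 * (1 - c + c * x ^+ 2) / (1 - x ^+ 2)).
Proof.
move=> /andP[xN1 x1].
have xp : 0 < 1 + x by lra.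
have xm : 0 < 1 - x by lra.
have dp : is_derive x 1 (fun y => ln (1 + y)) ((1 + x)^-1 * (0 + 1)).
  exact: (@is_derive1_comp _ (@ln R) (fun y => 1 + y) x _ _
            (is_derive1_ln xp)).
have dm : is_derive x 1 (fun y => ln (1 - y)) ((1 - x)^-1 * (0 - 1)).
  exact: (@is_derive1_comp _ (@ln R) (fun y => 1 - y) x _ _
            (is_derive1_ln xm)).
rewrite /artanh_gap; apply: is_derive_eq.
rewrite /= /GRing.scale/=.
have -> : 1 - x ^+ 2 = (1 + x) * (1 - x) by ring.
by field; rewrite !gt_eqF.
Qed.

Lemma artanh_gap_third {R : realType} (c : R) :
  artanh_gap c 3^-1 = ln 2 - 2 * (3^-1 + 3^-1 ^+ 3 / 3 + 3^-1 ^+ 5 / 5 +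
                        3^-1 ^+ 7 / 7 + c * (3^-1 ^+ 9 / 9)).
Proof.
rewrite /artanh_gap -ln_div ?posrE; last 2 first.
- by lra.
- by lra.
by congr (ln _ - _); field.
Qed.

(** [x = 1/3] is the point where [(1 + x) / (1 - x) = 2]. *)
Lemma ln4_bounds (R : realType) :
  138 / 10 ^+ 2 + 629 / 10 ^+ 5 <= ln (4 : R)
    <= 138 / 10 ^+ 2 + 63 / 10 ^+ 4.
Proof.
have -> : (4 : R) = 2 ^+ 2 by ring.
rewrite lnXn// -[ln 2 *+ 2]mulr_natl.
have g0 c : artanh_gap c (0 : R) = 0.
  rewrite /artanh_gap addr0 subr0 subrr !expr0n/= !mul0r !mulr0 !addr0.
  by rewrite mulr0 subrr.
have t0 : 0 <= 3^-1 :> R by rewrite invr_ge0.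
have sq (x : R) : 0 <= x <= 3^-1 -> 0 <= x ^+ 2 <= 9^-1.
  by move=> /andP[x0 x3]; rewrite sqr_ge0/=; nra.
have dom (x : R) : 0 <= x <= 3^-1 -> -1 < x < 1.
  by move=> /andP[x0 x3]; apply/andP; split; lra.
have lo : 0 <= artanh_gap 1 (3^-1 : R).
  rewrite -(g0 1).
  apply: (ge0_derive_le_endpoints _ _ _ t0
    (fun x h => is_derive_artanh_gap 1 x (dom x h))) => x /sq /andP[s0 s1].
  rewrite divr_ge0//; last lra.
  by rewrite mulr_ge0//; [rewrite mulr_ge0// exprn_even_ge0|lra].
(* [9/8] is the least [c] with [1 - c + c x^2 <= 0] for [0 <= x <= 1/3]. *)
have hi : 0 <= - artanh_gap (9 / 8) (3^-1 : R).
  rewrite -[leLHS]oppr0 -(g0 (9 / 8)).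
  apply: (ge0_derive_le_endpoints (- artanh_gap (9 / 8)) _ _ t0
    (fun x h => is_deriveN (is_derive_artanh_gap (9 / 8) x (dom x h))))
    => x /sq /andP[s0 s1].
  rewrite -mulNr -mulrN divr_ge0//; last lra.
  by rewrite mulr_ge0//; [rewrite mulr_ge0// exprn_even_ge0|lra].
rewrite !artanh_gap_third in lo hi.
by apply/andP; split; lra.
Qed.

(** * The equation defining the critical parameter *)

(** A closed form of [(1 + q) / (1 + s_star q)] in which monotonicity and
    continuity are visible. *)
Definition threshold {R : realType} (q : R) : R :=
  (1 + q) * (1 + Num.sqrt (2 - q^-1)) / 2.

(** With [w = sqrt (2 - 1/q)], the denominator [1 + s_star q] is
    [2 q (1 - w) / (1 - q)], and [1 - q = q (1 - w^2)] turns this into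
    [2 / (1 + w)]. *)
Lemma s_star_threshold {R : realType} (q : R) : 1 / 2 < q < 1 ->
  (1 + q) / (1 + s_star q) = threshold q.
Proof.
move=> /andP[q1 q2]; rewrite /s_star /threshold.
have q0 : 0 < q by lra.
have iq : 0 < 2 - q^-1.
  suff : q^-1 < 2 by lra.
  by rewrite -[2]invrK ltf_pV2 ?posrE ?invr_gt0//; lra.
set w := Num.sqrt (2 - q^-1).
have w2 : w ^+ 2 = 2 - q^-1 by rewrite sqr_sqrtr// ltW.
have w0 : 0 <= w by rewrite sqrtr_ge0.
have -> : Num.sqrt (q * (2 * q - 1)) = q * w.
  have -> : q * (2 * q - 1) = q ^+ 2 * (2 - q^-1) by field; rewrite gt_eqF.
  by rewrite sqrtrM ?sqr_ge0// sqrtr_sqr gtr0_norm.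
have qw : q * w ^+ 2 = 2 * q - 1.
  by rewrite w2 mulrBr mulfV ?gt_eqF//; ring.
have w21 : w ^+ 2 < 1 by nra.
have w1 : w < 1 by nra.
have -> : 1 + (1 - 3 * q + 2 * (q * w)) / (q - 1) = 2 * q * (1 - w) / (1 - q).
  have nq : q - 1 != 0 by rewrite lt_eqF//; lra.
  have nq' : 1 - q != 0 by rewrite gt_eqF//; lra.
  by field; rewrite nq nq'.
have h : 2 * q * (1 - w) / (1 - q) * ((1 + w) / 2) = 1.
  have -> : 1 - q = q * (1 - w ^+ 2) by lra.
  by field; rewrite subr_eq0 gt_eqF// gt_eqF.
have nz : 2 * q * (1 - w) / (1 - q) != 0.
  by apply: contra_eq_neq h => ->; rewrite mul0r eq_sym oner_neq0.
apply: (mulIf nz); rewrite divfK//.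
set D := _ / (1 - q) in h *.
transitivity ((1 + q) * (D * ((1 + w) / 2))); first by rewrite h mulr1.
by field.
Qed.

Lemma threshold_lt {R : realType} (p q : R) : 1 / 2 <= p -> p < q ->
  threshold p < threshold q.
Proof.
move=> p1 pq; rewrite /threshold ltr_pM2r//.
have p0 : 0 < p by lra.
have q0 : 0 < q by lra.
have : Num.sqrt (2 - p^-1) <= Num.sqrt (2 - q^-1).
  by rewrite ler_wsqrtr// lerD2l lerN2 lef_pV2 ?posrE// ltW.
have := sqrtr_ge0 (2 - p^-1); nra.
Qed.

Lemma threshold_continuous {R : realType} (q : R) : q != 0 ->
  {for q, continuous (@threshold R)}.
Proof.
move=> q0.
apply: cvgMl.
apply: cvgM; first by apply: cvgD; [exact: cvg_cst|exact: cvg_id].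
apply: cvgD; first exact: cvg_cst.
apply: (@continuous_comp _ _ _ (fun x : R => 2 - x^-1) Num.sqrt).
  by apply: cvgB; [exact: cvg_cst|exact: cvgV].
exact: sqrt_continuous.
Qed.

Lemma threshold_solution (R : realType) : exists q : R,
  65 / 10 ^+ 2 + 35 / 10 ^+ 5 <= q <= 65 / 10 ^+ 2 + 45 / 10 ^+ 5 /\
  threshold q = ln 4.
Proof.
pose a : R := 65 / 10 ^+ 2 + 35 / 10 ^+ 5.
pose b : R := 65 / 10 ^+ 2 + 45 / 10 ^+ 5.
have ab : a <= b by rewrite /a /b; lra.
have /andP[l1 l2] := ln4_bounds R.
(* [0.67998] squared is just above [2 - 1/a]; with [0.68] in its place the
   resulting bound on [threshold a] would exceed the lower bound on [ln 4]. *)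
have ha : threshold a <= ln 4.
  have : Num.sqrt (2 - a^-1) <= 68 / 10 ^+ 2 - 2 / 10 ^+ 5.
    rewrite -[leRHS]ger0_norm; last lra.
    have aV : a * a^-1 = 1 by rewrite mulfV// gt_eqF// /a; lra.
    rewrite -sqrtr_sqr ler_wsqrtr//; move: aV; rewrite {1}/a; lra.
  rewrite /threshold; move: (Num.sqrt _) => w hw; rewrite /a; lra.
have hb : ln 4 <= threshold b.
  have : 68 / 10 ^+ 2 <= Num.sqrt (2 - b^-1).
    rewrite -[leLHS]ger0_norm; last lra.
    have bV : b * b^-1 = 1 by rewrite mulfV// gt_eqF// /b; lra.
    rewrite -sqrtr_sqr ler_wsqrtr//; move: bV; rewrite {1}/b; lra.
  rewrite /threshold; move: (Num.sqrt _) => w hw; rewrite /b; lra.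
have cf : {within `[a, b], continuous (@threshold R)}.
  apply: continuous_in_subspaceT => x; rewrite inE/= in_itv/= => /andP[xa _].
  by apply: threshold_continuous; rewrite gt_eqF// (lt_le_trans _ xa)// /a; lra.
have := @IVT R _ a b (ln 4) ab cf.
case.
  by rewrite ge_min ha/= le_max hb orbT.
by move=> q; rewrite in_itv/= => qab e; exists q; split.
Qed.

(** * The comparison with ln 4 *)

Theorem proposition2p6 (R : realType) :
  exists p_star : R,
    [/\ unique (@is_p_star R) p_star,
        `|p_star - (65 / 10 ^+ 2 + 4 / 10 ^+ 4)| <= 5 / 10 ^+ 5 &
        forall p : R, p_star < p < 1 ->
        forall s : R, 0 < s < 1 ->
          ((ln 4 * (s / (s + 1)))%:E
           < rate_function (bernoulli_mgf p)
               (p + 2 * Num.sqrt (p * (1 - p)) * Num.sqrt s / (1 + s)))%E].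
Proof.
have [q [/andP[qa qb] tq]] := threshold_solution R.
have q1 : 1 / 2 < q < 1 by apply/andP; split; lra.
exists q; split.
- split; first by split=> //; rewrite s_star_threshold.
  move=> r [r1]; rewrite s_star_threshold// -tq => e.
  have /andP[? ?] := r1; have /andP[? ?] := q1.
  apply/eqP; rewrite eq_le; apply/andP; split; rewrite leNgt; apply/negP.
    by move=> lt; have := threshold_lt r q ltac:(lra) lt; rewrite e ltxx.
  by move=> lt; have := threshold_lt q r ltac:(lra) lt; rewrite e ltxx.
- by rewrite ler_norml; apply/andP; split; lra.
move=> p /andP[qp p1] s /andP[s0 s1].
set sg := Num.sqrt (p * (1 - p)); set r := Num.sqrt s.
set a := p + _.
have p01 : 0 <= p <= 1 by apply/andP; split; lra.
have [a1|a1] := ltP 1 a.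
  by rewrite rate_function_bernoulli_eqy// ltry.
have p12 : 1 / 2 <= p < 1 by apply/andP; split; lra.
have v0 : 0 < p * (1 - p) by nra.
have sg2 : sg ^+ 2 = p * (1 - p) by rewrite sqr_sqrtr// ltW.
have r2 : r ^+ 2 = s by rewrite sqr_sqrtr// ltW.
have s10 : 0 < 1 + s by lra.
have d0 : 0 <= a - p.
  by rewrite /a addrAC subrr add0r !mulr_ge0 ?sqrtr_ge0// invr_ge0 ltW.
have d2 : (a - p) ^+ 2 = 4 * (p * (1 - p)) * (s / (1 + s) ^+ 2).
  have -> : (a - p) ^+ 2 = 4 * sg ^+ 2 * (r ^+ 2 / (1 + s) ^+ 2).
    by rewrite /a; field; rewrite gt_eqF.
  by rewrite sg2 r2.
apply: lt_le_trans (rate_function_bernoulli_ge _ _ p12 _); last by lra.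
rewrite d2 lte_fin.
pose u := (1 + s)^-1.
have u1 : u < 1 by rewrite invf_plt ?posrE//; lra.
have u2 : 1 / 2 < u by rewrite -invf_pgt ?posrE//; lra.
have us : s * u = 1 - u.
  by rewrite /u; field; rewrite gt_eqF.
have -> : 4 * (p * (1 - p)) * (s / (1 + s) ^+ 2) / (2 * (p * (1 - p))) =
          2 * u * (s * u).
  by rewrite /u; field; rewrite !gt_eqF//; lra.
rewrite [s + 1]addrC -/u ltr_pM2r; last by rewrite us; lra.
(* This is where [a <= 1] enters, as [(a - p)^2 <= (1 - p)^2]. *)
have w1 : Num.sqrt (2 - p^-1) <= 2 * u - 1.
  rewrite -[leRHS]ger0_norm; last lra.
  rewrite -sqrtr_sqr ler_wsqrtr//.
  have : 4 * (p * (1 - p)) * ((s * u) * u) <= (1 - p) ^+ 2.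
    have -> : s * u * u = s / (1 + s) ^+ 2 by rewrite /u; field; rewrite gt_eqF.
    rewrite -d2; nra.
  rewrite us => h.
  have {}h : 4 * ((1 - u) * u) * p <= 1 - p.
    by rewrite -(@ler_pM2r _ (1 - p)); lra.
  rewrite -ler_pdivlMr in h; last lra.
  have e : (1 - p) / p = p^-1 - 1 by field; rewrite gt_eqF//; lra.
  rewrite e in h; lra.
have : threshold q < threshold p by apply: threshold_lt => //; lra.
rewrite tq.
have := sqrtr_ge0 (2 - p^-1); rewrite /threshold.
nra.
Qed.
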